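(* Suppose that $L\in\mathrm{SL}(4,\mathbb{Z})$ is a matrix with a Jordan block (i.e. not diagonalizable over $\mathbb{C}$) and no eigenvalues of modulus $1$. Then $L$ is conjugate, by an element of $\mathrm{GL}(4,\mathbb{Z})$, to a block matrix of the form $$\begin{bmatrix}A & C\\ 0 & B\end{bmatrix},$$ where $A,B\in\mathrm{GL}(2,\mathbb{Z})$, $C\neq0$ is a $2\times2$ integer matrix, and the characteristic polynomials of $A$ and $B$ are equal and have two distinct real roots. *)

(* Defs.v *)
From HB Require Export structures.
From mathcomp Require Export all_boot all_order all_algebra.
From mathcomp Require Export reals.
From mathcomp Require Export complex.

Set Implicit Arguments.
Unset Strict Implicit.
Unset Printing Implicit Defensive.

(* Main.v *)
Require Import Defs.
From mathcomp Require boolp.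
From mathcomp Require Import separable qpoly polyorder zify ring.
Import Order.TTheory GRing.Theory Num.Theory.
Local Open Scope ring_scope.

(* A rational eigenvalue of L would be a unit of Z, hence of modulus 1, so the
   characteristic polynomial p has no rational root.  Since L is not
   diagonalizable, p is inseparable, which leaves only p = q^2 with q an
   irreducible monic integral quadratic.  Then M = q(L) is nonzero (q is
   separable) and M^2 = 0.  In a basis of Z^4 adapted to the Smith normal form
   of M, the kernel of M is spanned by the last basis vectors and is
   L-invariant; it has rank 2, as otherwise L would have an integral
   eigenvalue.  The two diagonal blocks then have characteristic polynomials
   with product q^2, hence both equal to q.  If C vanished then q(L) = 0 by
   Cayley-Hamilton.  A nonpositive discriminant would force q(0) = 1 and give a
   root of modulus 1. *)

Local Notation intQ := (map_poly (intr : int -> rat)).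

(** Over a closed field [f] is, up to a scalar, a product of distinct linear factors, and the
    minimal polynomial of [A] divides it. *)
Lemma separable_annihilator_diagonalizable (F : closedFieldType) (n : nat)
    (A : 'M[F]_n.+1) (f : {poly F}) :
  separable_poly f -> horner_mx A f = 0 -> diagonalizable A.
Proof.
move=> sf fA; apply/diagonalizableP.
have [rs frs] := closed_field_poly_normal f.
have lf0 : lead_coef f != 0 by rewrite lead_coef_eq0 separable_poly_neq0.
exists rs; last by rewrite -(dvdpZr _ _ lf0) -frs mxminpoly_min.
rewrite -separable_prod_XsubC.
by move: sf; rewrite frs (eqp_separable (eqp_scale _ lf0)).
Qed.

(** * Monic integral polynomials: rational factors and real roots *)

Lemma unit_intP (m : int) : m \is a GRing.unit -> m = 1 \/ m = -1.
Proof. by case/orP=> /eqP ->; [left | right]. Qed.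

(** Gauss's lemma gives an integral factorization of [p]. The two leading coefficients multiply to
    1, so they are the same sign, and multiplying both factors by it makes them monic. *)
Lemma monic_dvdp_int (p : {poly int}) (f : {poly rat}) :
  p \is monic -> f %| intQ p ->
  exists q r : {poly int}, [/\ q \is monic, p = q * r & intQ q %= f].
Proof.
move=> mp /dvdpP_rat_int[q [a a0 ->] [r pqr]].
have lqr : lead_coef q * lead_coef r = 1 by rewrite -lead_coefM -pqr (monicP mp).
have lq2 : lead_coef q * lead_coef q = 1.
  have : lead_coef q \is a GRing.unit by apply/unitrPr; exists (lead_coef r).
  by case/unit_intP => ->.
exists (lead_coef q *: q), (lead_coef q *: r); split.
- by rewrite monicE lead_coefZ lq2.
- by rewrite -scalerAl -scalerAr scalerA lq2 scale1r.
have lq0 : (lead_coef q)%:~R != 0 :> rat.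
  by rewrite intr_eq0; apply/eqP => h; move: lq2; rewrite h.
rewrite linearZ /=; apply: (eqp_trans (eqp_scale _ lq0)).
by rewrite eqp_sym eqp_scale.
Qed.

Lemma size_intQ (q : {poly int}) : size (intQ q) = size q.
Proof. by rewrite size_map_inj_poly //; apply: intr_inj. Qed.

Lemma intQ_inj : injective intQ.
Proof. by apply: map_inj_poly => //; apply: intr_inj. Qed.

(** Rational root theorem: ['X - x%:P] is associated with a monic integral linear factor of [p],
    whose constant coefficient divides that of [p]. *)
Lemma unit_rational_root (p : {poly int}) (x : rat) :
  p \is monic -> p`_0 \is a GRing.unit -> root (intQ p) x ->
  exists2 a : int, a \is a GRing.unit & root p a.
Proof.
move=> mp p0; rewrite root_factor_theorem => /monic_dvdp_int[//|q [r [mq pqr qx]]].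
have sq : (size q = 2)%N by rewrite -size_intQ (eqp_size qx) size_XsubC.
have qE : q = 'X - (- q`_0)%:P.
  have q1 : q`_1 = 1 by have := monicP mq; rewrite lead_coefE sq.
  apply/polyP => i; rewrite polyCN opprK coefD coefX coefC.
  case: i => [|[|i]] /=; rewrite ?add0r ?addr0 //.
  by rewrite nth_default ?sq.
exists (- q`_0); last by rewrite pqr rootM {1}qE root_XsubC eqxx.
by move: p0; rewrite pqr coef0M unitrM unitrN => /andP[].
Qed.

(** In characteristic 0 a nonconstant polynomial has nonzero derivative, so separability can fail
    only through a square factor. *)
Lemma inseparable_square_factor (F : realDomainType) (p : {poly F}) :
  ~~ separable_poly p -> exists2 u : {poly F}, (size u != 1)%N & u ^+ 2 %| p.
Proof.
move=> nsp; apply: boolp.contrapT => nu; case/negP: nsp; apply/separable_polyP.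
split=> [|u _ su]; last by rewrite -size_poly_eq0 size_deriv -?lt0n ?ltn_predRL.
by apply/poly_square_freeP => u su; apply/negP => up; apply: nu; exists u.
Qed.

(** A square factor [u ^+ 2] of a quartic has [u] of degree at most 2, and degree 1 would give a
    rational root. The monic integral associate [q] of [u] then satisfies [p = q * q] by comparing
    degrees. *)
Lemma inseparable_quartic_square (p : {poly int}) :
  p \is monic -> (size p = 5)%N -> (forall x, ~~ root (intQ p) x) ->
  ~~ separable_poly (intQ p) ->
  exists q : {poly int}, [/\ q \is monic, (size q = 3)%N, p = q * q &
    irreducible_poly (intQ q)].
Proof.
move=> mp sp nr /inseparable_square_factor[u su u2p].
have p0 : intQ p != 0 by rewrite -size_poly_eq0 size_intQ sp.
have up : u %| intQ p by apply: dvdp_trans u2p; rewrite expr2 dvdp_mulr.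
have u0 : u != 0 by apply: contraNneq p0 => u0; move: up; rewrite u0 dvd0p.
have sp5 : (size (u * u)%R <= 5)%N by rewrite -expr2 -sp -(size_intQ p) dvdp_leq.
have su3 : (size u = 3)%N.
  have su2 : (size u != 2)%N.
    apply/eqP => /poly2_root[x ux]; have := nr x.
    by rewrite (root_dvdp up ux).
  move: sp5 su2 su; rewrite size_mul //; move: u0; rewrite -size_poly_eq0.
  by case: (size u) => [|[|[|[|m]]]] //; lia.
have [q [r [mq pqr qu]]] := monic_dvdp_int _ _ mp up.
have sq : (size q = 3)%N by rewrite -size_intQ (eqp_size qu).
exists q; split => //; last first.
  apply: cubic_irreducible; first by rewrite size_intQ sq.
  by move=> x; apply: contra (nr x) => /root_dvdp; apply; rewrite pqr rmorphM dvdp_mulr.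
apply: intQ_inj; apply/eqP.
rewrite eq_sym -eqp_monic ?monic_map ?monicMl //.
have q0 : intQ q != 0 by rewrite -size_poly_eq0 size_intQ sq.
have qq_uu := eqp_trans (eqp_mull _ qu) (eqp_mulr _ qu).
rewrite -dvdp_size_eqp; last by rewrite rmorphM (eqp_dvdl _ qq_uu).
by rewrite !size_intQ size_mul -?size_poly_eq0 sq ?sp.
Qed.

Lemma irreducible_intQ_separable (q : {poly int}) :
  irreducible_poly (intQ q) -> separable_poly (intQ q).
Proof.
move=> irr; have sq : (1 < size (intQ q))%N by case: irr.
have q'0 : (intQ q)^`() != 0.
  by rewrite -size_poly_eq0 size_deriv -lt0n -ltnS prednK // ltnW.
rewrite unlock irreducible_poly_coprime //; apply/negP => /(dvdp_leq q'0).
by rewrite size_deriv leqNgt prednK ?leqnn // ltnW.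
Qed.

(** Over the rationals the irreducible [q] divides [a] or [b]. Monic polynomials of equal degree
    that divide one another coincide, and cancelling [q] settles the other factor. *)
Lemma quadratic_factors_of_square (q a b : {poly int}) :
  q \is monic -> a \is monic -> b \is monic ->
  (size q = 3)%N -> (size a = 3)%N -> (size b = 3)%N ->
  irreducible_poly (intQ q) -> a * b = q * q -> a = q /\ b = q.
Proof.
move=> mq ma mb sq sa sb irr abq.
have eq_q (c : {poly int}) : c \is monic -> (size c = 3)%N -> intQ q %| intQ c -> c = q.
  move=> mc sc qc; apply: intQ_inj; apply/eqP.
  by rewrite eq_sym -eqp_monic ?monic_map // -dvdp_size_eqp // !size_intQ sq sc.
have q0 : q != 0 by rewrite monic_neq0.
have : intQ q %| intQ a * intQ b by rewrite -rmorphM abq rmorphM dvdp_mulr.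
have [qa _|nqa] := boolP (intQ q %| intQ a).
  have aq := eq_q _ ma sa qa; split=> //.
  by apply: (mulfI q0); rewrite -{1}aq abq.
rewrite Gauss_dvdpr ?irreducible_poly_coprime // => /(eq_q _ mb sb) bq.
by split=> //; apply: (mulIf q0); rewrite -{1}bq abq.
Qed.

Lemma hyperbolic_quadratic_real_roots (R : rcfType) (q : {poly int}) :
  q \is monic -> (size q = 3)%N -> q`_0 \is a GRing.unit ->
  (forall z : R[i], root (map_poly intr q) z -> `|z| != 1) ->
  exists x y : R,
    [/\ x != y, root (map_poly intr q) x & root (map_poly intr q) y].
Proof.
move=> mq sq q0 nz.
have mm (F : numDomainType) : (map_poly intr q : {poly F}) \is monic.
  by rewrite monic_map.
have sz (F : numDomainType) : size (map_poly intr q : {poly F}) = 3%N.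
  by rewrite size_map_inj_poly //; apply: intr_inj.
have two (F : numDomainType) : 2 != 0 :> F by rewrite pnatr_eq0.
have [D0|D0] := ltP 0 (q`_1 ^+ 2 - 4 * q`_0).
  set r : R := Num.sqrt (q`_1 ^+ 2 - 4 * q`_0)%:~R.
  have r2 : r ^+ 2 = (map_poly intr q)`_1 ^+ 2 - 4 * (map_poly intr q)`_0.
    rewrite sqr_sqrtr ?ler0z 1?ltW // !coef_map /= rmorphB rmorphXn rmorphM /=.
    by [].
  have r0 : 0 < r by rewrite sqrtr_gt0 ltr0z.
  exists ((- (map_poly intr q)`_1 + r) / 2), ((- (map_poly intr q)`_1 - r) / 2).
  split.
  - rewrite -subr_eq0 -mulrBl opprD !opprK addrACA addNr add0r.
    by rewrite mulf_neq0 ?invr_eq0 // gt_eqF // addr_gt0.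
  - exact: (FieldMonic.deg2_poly_root2 (two R) (sz R) (mm R) r2).
  - exact: (FieldMonic.deg2_poly_root1 (two R) (sz R) (mm R) r2).
(* A constant coefficient -1 would make the discriminant at least 4. *)
have q01 : q`_0 = 1.
  have b2 := sqr_ge0 q`_1.
  by move: D0; case/orP: q0 => /eqP -> // D0; lia.
rewrite q01 in D0.
set b : R := (q`_1)%:~R.
set s : R := Num.sqrt (4 - b ^+ 2).
have s2 : s ^+ 2 = 4 - b ^+ 2.
  rewrite sqr_sqrtr // subr_ge0 -rmorphXn -[4]/(4%:~R) ler_int.
  by move: D0; rewrite mulr1 subr_le0.
have bC : (map_poly intr q : {poly R[i]})`_1 = b%:C%C.
  by rewrite coef_map /= rmorph_int.
(* The squared modulus of this root is [(b ^+ 2 + (4 - b ^+ 2)) / 4], that is 1. *)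
have /nz/eqP[] : root (map_poly intr q) ((- b%:C + 'i * s%:C)%C / 2).
  rewrite -bC; apply: (FieldMonic.deg2_poly_root2 (two _) (sz _) (mm _)).
  rewrite bC coef_map /= q01 exprMn sqr_i -!rmorphXn /= s2.
  by rewrite rmorphB rmorph_nat; ring.
have -> : (- b%:C + 'i * s%:C)%C / 2 = (- b / 2 +i* (s / 2))%C.
  rewrite -(rmorph_nat (real_complex R)) -fmorphV /=.
  by simpc.
rewrite normc_def /= !expr_div_n s2 sqrrN -mulrDl addrC subrK.
have -> : 4 / 2 ^+ 2 = 1 :> R by field.
by rewrite sqrtr1.
Qed.

(** * Characteristic polynomials and block triangular form over the integers *)

Lemma char_poly_conj (R : comUnitRingType) (n : nat) (P A : 'M[R]_n) :
  P \in unitmx -> char_poly (P *m A *m invmx P) = char_poly A.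
Proof.
move=> uP; rewrite /char_poly /char_poly_mx !map_mxM /=.
have uPX : map_mx (@polyC R) P *m map_mx (@polyC R) (invmx P) = 1%:M.
  by rewrite -map_mxM /= mulmxV // map_mx1.
have -> : 'X%:M - map_mx polyC P *m map_mx polyC A *m map_mx polyC (invmx P) =
    map_mx polyC P *m ('X%:M - map_mx polyC A) *m map_mx polyC (invmx P).
  by rewrite mulmxBr mulmxBl mul_mx_scalar -scalemxAl uPX scalemx1.
rewrite !det_mulmx mulrAC -det_mulmx uPX.
by rewrite det1 mul1r.
Qed.

Lemma char_poly_ublock (R : comNzRingType) (m n : nat) (A : 'M[R]_m)
    (C : 'M_(m, n)) (B : 'M_n) :
  char_poly (block_mx A C 0 B) = char_poly A * char_poly B.
Proof.
rewrite /char_poly /char_poly_mx map_block_mx map_mx0 scalar_mx_block.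
by rewrite opp_block_mx add_block_mx oppr0 addr0 det_ublock.
Qed.

(** Laplace expansion along row [i] leaves the single factor ['X - (N i i)%:P]. This and its column
    analogue exclude kernels of rank 1 and 3 below. *)
Lemma row_diag_root_char (R : idomainType) (n : nat) (N : 'M[R]_n) (i : 'I_n) :
  (forall j, j != i -> N i j = 0) -> root (char_poly N) (N i i).
Proof.
move=> Ni; rewrite /char_poly (expand_det_row _ i) (bigD1 i) //= big1 ?addr0.
  by rewrite !mxE eqxx mulr1n rootM root_XsubC eqxx.
by move=> j ji; rewrite !mxE eq_sym (negPf ji) Ni // subrr mul0r.
Qed.

Lemma col_diag_root_char (R : idomainType) (n : nat) (N : 'M[R]_n) (j : 'I_n) :
  (forall i, i != j -> N i j = 0) -> root (char_poly N) (N j j).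
Proof.
move=> Nj; rewrite /char_poly (expand_det_col _ j) (bigD1 j) //= big1 ?addr0.
  by rewrite !mxE eqxx mulr1n rootM root_XsubC eqxx.
by move=> i ij; rewrite !mxE (negPf ij) Nj // subrr mul0r.
Qed.

(** [E] may be rectangular, so that it can be a horizontal half of a change of basis, with [K] the
    corresponding diagonal block. *)
Lemma horner_mx_intertwine (R : comNzRingType) (m n : nat)
    (E : 'M[R]_(m.+1, n.+1)) (K : 'M_m.+1) (N : 'M_n.+1) (q : {poly R}) :
  E *m N = K *m E -> E *m horner_mx N q = horner_mx K q *m E.
Proof.
move=> EN; elim/poly_ind: q => [|q c IHq]; first by rewrite !rmorph0 mulmx0 mul0mx.
rewrite !rmorphD !rmorphM /= !horner_mx_X !horner_mx_C mulmxDr mulmxDl.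
by rewrite mul_mx_scalar mul_scalar_mx mulmxA IHq -!mulmxA EN.
Qed.

Lemma square_zero_commutant_block (L M : 'M[int]_4) :
  M != 0 -> M *m M = 0 -> L *m M = M *m L ->
  (forall a, ~~ root (char_poly L) a) ->
  exists (P : 'M[int]_4) (A B C : 'M[int]_2),
    P \in unitmx /\ P *m L *m invmx P = block_mx A C 0 B.
Proof.
move=> M0 MM LM nr.
have [U uU [V uV [d sd ME]]] := int_Smith_normal_form M.
set D := (\matrix_(i, j) _) in ME.
set N := invmx U *m L *m U.
have NE : invmx U *m L *m invmx (invmx U) = N by rewrite invmxK.
have uU' : invmx U \in unitmx by rewrite unitmx_inv.
have nrN a : ~~ root (char_poly N) a by rewrite -NE char_poly_conj.
have ND : N *m D = D *m (V *m L *m invmx V).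
  (* Both sides reduce to [L *m M] and [M *m L] between [invmx U] and [invmx V]. *)
  have -> : D = invmx U *m M *m invmx V by rewrite ME !mulmxA mulVmx // mul1mx mulmxK.
  rewrite /N !mulmxA mulmxKV // mulmxK // -!mulmxA; congr (_ *m _).
  by rewrite !mulmxA LM.
clearbody N.
have DE (i j : 'I_4) : D i j = d`_i *+ (i == j) by rewrite mxE.
(* Entry [(i, j)] of [ND] equates [N i j * d]_j[with a multiple of]d[_i]. *)
have Nij (i j : 'I_4) : d`_i = 0 -> d`_j != 0 -> N i j = 0.
  move=> di dj; have := congr1 (fun W : 'M_4 => W i j) ND.
  rewrite [LHS]mxE [RHS]mxE (bigD1 j) //= big1 => [|k kj]; last first.
    by rewrite DE (negPf kj) mulr0.
  rewrite big1 => [|k _]; last by rewrite DE di mul0rn mul0r.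
  by rewrite DE eqxx addr0 => /eqP; rewrite mulf_eq0 (negPf dj) orbF => /eqP.
(* The entries of [d] form a divisibility chain, and 0 divides only 0; past the end of [d] the
   default value is 0 as well. *)
have dS i j : (i <= j)%N -> d`_i = 0 -> d`_j = 0.
  move=> ij di; case: (ltnP j (size d)) => [jd|]; last exact: nth_default.
  have := sorted_leq_nth dvdz_trans dvdzz 0 sd.
  move=> /(_ i j); rewrite !inE jd (leq_ltn_trans ij) // ij di dvd0z.
  by move=> /(_ isT isT isT)/eqP.
have d0 : d`_0 != 0.
  apply: contraNneq M0 => d0.
  rewrite ME (_ : D = 0) ?mulmx0 ?mul0mx //.
  by apply/matrixP => i j; rewrite DE mxE (dS 0) ?mul0rn.
have d3 : d`_3 = 0.
  have detD : \det D = 0.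
    have: \det M ^+ 2 == 0 by rewrite expr2 -det_mulmx MM det0.
    rewrite sqrf_eq0 ME !det_mulmx !mulf_eq0.
    have nz (W : 'M[int]_4) : W \in unitmx -> \det W == 0 = false.
      by rewrite unitmxE; apply: contraTF => /eqP ->; rewrite unitr0.
    by rewrite (nz U) // (nz V) // orbF => /eqP.
  have Ddiag : D = diag_mx (\row_(i < 4) d`_i).
    by apply/matrixP => i j; rewrite DE !mxE.
  move: detD; rewrite Ddiag det_diag => /eqP/prodf_eq0[i _]; rewrite mxE => /eqP.
  by apply: dS; rewrite -ltnS.
have d1 : d`_1 != 0.
  apply: contraNneq (nrN (N 0 0)) => d1.
  apply: col_diag_root_char => i i0; apply: Nij => //.
  by apply: dS d1; rewrite lt0n.
have d2 : d`_2 = 0.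
  apply/eqP; apply: contraNT (nrN (N ord_max ord_max)) => d2.
  apply: row_diag_root_char => j j3; apply: Nij => //.
  apply: contraNneq d2 => dj; apply/eqP; apply: dS dj.
  by case: j j3 => [[|[|[|[|]]]]].
exists (invmx U), (ulsubmx (N : 'M_(2 + 2))), (drsubmx (N : 'M_(2 + 2))),
  (ursubmx (N : 'M_(2 + 2))).
split=> //; rewrite NE; suff <- : dlsubmx (N : 'M_(2 + 2)) = 0.
  exact: (esym (@submxK _ 2 2 2 2 N)).
apply/matrixP => i j; rewrite !mxE; apply: Nij => /=.
  by apply: dS d2.
apply: contraNneq d1 => dj; apply/eqP; apply: dS dj.
by have := ltn_ord j; lia.
Qed.

Theorem proposition5 (R : realType) (L : 'M[int]_4)
    (detL : \det L = 1)
    (jordanL : ~ diagonalizable (map_mx intr L : 'M[R[i]]_4))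
    (hypL : forall z : R[i],
        eigenvalue (map_mx intr L : 'M[R[i]]_4) z -> `|z| != 1) :
  exists (P : 'M[int]_4) (A B C : 'M[int]_2),
    [/\ P \in unitmx,
        P *m L *m invmx P = block_mx A C 0 B,
        A \in unitmx /\ B \in unitmx,
        C != 0 &
        char_poly A = char_poly B /\
        (exists x y : R,
           [/\ x != y,
               root (map_poly intr (char_poly A)) x &
               root (map_poly intr (char_poly A)) y])].
Proof.
set p := char_poly L.
have mp : p \is monic := char_poly_monic L.
have sp : size p = 5%N := size_char_poly L.
have p0 : p`_0 = 1 by rewrite char_poly_det detL mulr1 -signr_odd.
have nz (z : R[i]) : root (map_poly intr p) z -> `|z| != 1.
  by rewrite map_char_poly -eigenvalue_root_char; apply: hypL.
have nr x : ~~ root (intQ p) x.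
  apply/negP => /unit_rational_root[]//; first by rewrite p0.
  move=> a ua pa; have /nz/eqP[] : root (map_poly intr p) (a%:~R : R[i]).
    exact: rmorph_root pa.
  by case/unit_intP: ua => ->; rewrite ?rmorphN ?normrN normr1.
have nri a : ~~ root p a.
  by apply: contra (nr a%:~R); apply: rmorph_root.
have sepL (f : {poly int}) : separable_poly (intQ f) -> horner_mx L f != 0.
  move=> sf; apply/eqP => fL; apply: jordanL.
  (* Factoring the embedding of the integers through the rationals carries separability over to
     [R[i]]. *)
  have ratr_intr : (intr : int -> R[i]) =1 ratr \o intr.
    by move=> m /=; rewrite ratr_int.
  apply: (@separable_annihilator_diagonalizable _ _ _ (map_poly intr f)).
    by rewrite (eq_map_poly ratr_intr) map_poly_comp separable_map.
  by rewrite -map_horner_mx fL map_mx0.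
have nsp : ~~ separable_poly (intQ p).
  by apply/negP => /sepL/eqP; apply; apply: Cayley_Hamilton.
have [q [mq sq pq irr]] := inseparable_quartic_square _ mp sp nr nsp.
have uq : q`_0 \is a GRing.unit.
  by apply/unitrPr; exists q`_0; rewrite -coef0M -pq.
set M := horner_mx L q.
have M0 : M != 0 by apply/sepL/irreducible_intQ_separable.
have MM : M *m M = 0.
  by rewrite -[_ *m _]/(M * M) -rmorphM -pq; apply: Cayley_Hamilton.
have LM : L *m M = M *m L by apply: comm_mx_horner.
have [P [A [B [C [uP PL]]]]] := square_zero_commutant_block _ _ M0 MM LM nri.
have cAB : char_poly A * char_poly B = q * q.
  by rewrite -(char_poly_ublock _ _ _ A C B) -pq -[RHS](char_poly_conj _ _ _ L uP) -PL.
have [cA cB] : char_poly A = q /\ char_poly B = q.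
  by apply: (quadratic_factors_of_square _ _ _ _ _ _ _ _ _ irr cAB);
    rewrite ?char_poly_monic ?size_char_poly.
have uAB (W : 'M[int]_2) : char_poly W = q -> W \in unitmx.
  by move=> cW; move: uq; rewrite -cW char_poly_det -signr_odd mul1r.
exists P, A, B, C; split=> //; first by split; apply: uAB.
  apply: contraNneq M0 => C0.
  (* With [C = 0] the upper and lower halves of [P] intertwine [L] with [A] and [B] separately.
     Since [q] annihilates both blocks, [P *m M = 0], and invertibility of [P] gives [M = 0]. *)
  set Pu := usubmx (P : 'M_(2 + 2, 4)); set Pd := dsubmx (P : 'M_(2 + 2, 4)).
  have PE : col_mx Pu Pd = P by apply: vsubmxK.
  have PLN : col_mx (Pu *m L) (Pd *m L) = col_mx (A *m Pu) (B *m Pd).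
    have := mul_block_col A 0 0 B Pu Pd; rewrite !mul0mx addr0 add0r => <-.
    by rewrite -mul_col_mx PE -[X in block_mx A X]C0 -PL mulmxKV.
  have [uM dM] := eq_col_mx PLN.
  have PuM : Pu *m M = 0.
    rewrite (horner_mx_intertwine _ _ _ _ _ _ q uM) -cA.
    by rewrite [X in X *m _]Cayley_Hamilton mul0mx.
  have PdM : Pd *m M = 0.
    rewrite (horner_mx_intertwine _ _ _ _ _ _ q dM) -cB.
    by rewrite [X in X *m _]Cayley_Hamilton mul0mx.
  have PM : P *m M = 0.
    have := mul_col_mx Pu Pd M; rewrite PE PuM PdM => ->; exact: (@col_mx0 _ 2 2 4).
  by rewrite -[M](mulKmx uP) PM mulmx0.
rewrite cA cB; split=> //.
apply: hyperbolic_quadratic_real_roots => // z qz; apply: nz.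
by rewrite pq rmorphM rootM qz.
Qed.
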